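(* Let $\Omega\subset\mathbb{R}^n$ be a Borel set, let $F\subset\overline{\Omega}$ be non-empty and closed with $\mathcal{L}^n(F\cap\Omega)=0$, and let $\mu\in\mathrm{Dens}(F)$. Then $\mu$ is an extremal point of $\mathrm{Dens}(F)$ if and only if for every $B\in\mathcal{B}(\Omega)$ either $\mu(B)=0$ or $\mu(\Omega\setminus B)=0$.
   Context: $\mathcal{B}(\Omega)$ is the Borel $\sigma$-algebra of $\Omega$ and $\mathcal{L}^n$ is Lebesgue measure. A measure is a finitely additive real-valued set function. $\mathrm{ba}(\Omega,\mathcal{B}(\Omega),\mathcal{L}^n)$ is the set of bounded measures $\mu$ on $\mathcal{B}(\Omega)$ such that $\mathcal{L}^n(B)=0$ implies $\mu(B)=0$ for all $B\in\mathcal{B}(\Omega)$. $F_\delta$ denotes the open $\delta$-neighbourhood of $F$ in $\mathbb{R}^n$. A density measure for $F$ is a $\mu\in\mathrm{ba}(\Omega,\mathcal{B}(\Omega),\mathcal{L}^n)$ with $\mu\geq0$ and $\mu(F_\delta\cap\Omega)=\mu(\Omega)=1$ for all $\delta>0$. $\mathrm{Dens}(F)$ is the (convex) set of all density measures for $F$. A point $m$ of a convex set $M$ is extremal if $m=c_1m_1+c_2m_2$ with $m_1,m_2\in M$, $m_1\neq m_2$, $c_1,c_2\in[0,1]$, $c_1+c_2=1$ implies $c_1=1-c_2\in\{0,1\}$. *)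

(* Defs.v *)
From HB Require Import structures.
From mathcomp Require Import all_boot all_order all_algebra.
From mathcomp Require Import all_classical all_reals all_analysis.

Set Implicit Arguments.
Unset Strict Implicit.
Unset Printing Implicit Defensive.

Import Order.TTheory GRing.Theory Num.Theory.
Import numFieldNormedType.Exports.

Local Open Scope classical_set_scope.
Local Open Scope ring_scope.

(* The norm on ['rV[R]_n] in the library is the sup norm, hence this one. *)
Definition eucl_dist (R : realType) (n : nat) (x y : 'rV[R]_n) : R :=
  Num.sqrt (\sum_i (x ord0 i - y ord0 i) ^+ 2).

Definition nbhd_set (R : realType) (n : nat) (F : set 'rV[R]_n) (delta : R) :
    set 'rV[R]_n :=
  [set x | exists2 y, F y & eucl_dist x y < delta].

Definition closed_box (R : realType) (n : nat) (a b : 'rV[R]_n) :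
    set 'rV[R]_n :=
  [set x | forall i, a ord0 i <= x ord0 i <= b ord0 i].

(* Lebesgue outer measure: infimum of the total volume over the countable (or
   finite) covers by closed boxes. Its restriction to the Borel sets is the
   n-dimensional Lebesgue measure. The index set [P] allows for finite covers,
   so that the empty set is null also for [n = 0]. *)
Definition lebesgue_n (R : realType) (n : nat) (A : set 'rV[R]_n) : \bar R :=
  ereal_inf [set v | exists (P : set nat) (a b : nat -> 'rV[R]_n),
    [/\ forall k i, a k ord0 i <= b k ord0 i,
        A `<=` \bigcup_(k in P) closed_box (a k) (b k) &
        v = (\esum_(k in P) (\prod_i (b k ord0 i - a k ord0 i))%:E)%E]].

Definition borel_set (T : topologicalType) : set (set T) :=
  <<s [set U : set T | open U] >>.

(* Borel sigma-algebra of the subspace [Omega], as a family of subsets of T. *)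
Definition borel_on (T : topologicalType) (Omega : set T) : set (set T) :=
  <<s Omega, [set U `&` Omega | U in [set U : set T | open U]] >>.

(* A real-valued set function on [borel_on Omega] is represented by its
   extension by 0 to all sets (first clause), so that equality of set functions
   on [borel_on Omega] is Leibniz equality. [R^o] is R seen as an R-module,
   which makes the type of set functions an R-module. *)
Record is_ba (R : realType) (n : nat) (Omega : set 'rV[R]_n)
    (mu : set 'rV[R]_n -> R^o) : Prop := IsBa {
  ba_out : forall B, ~ borel_on Omega B -> mu B = 0;
  ba_additive : forall A B, borel_on Omega A -> borel_on Omega B ->
    A `&` B = set0 -> mu (A `|` B) = mu A + mu B;
  ba_bounded : exists M : R, forall B, borel_on Omega B -> `|mu B| <= M;
  ba_null : forall B, borel_on Omega B -> lebesgue_n B = 0%E -> mu B = 0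
}.

Definition ba (R : realType) (n : nat) (Omega : set 'rV[R]_n) :
    set (set 'rV[R]_n -> R^o) :=
  [set mu | is_ba Omega mu].

Definition Dens (R : realType) (n : nat) (Omega F : set 'rV[R]_n) :
    set (set 'rV[R]_n -> R^o) :=
  [set mu | [/\ ba Omega mu,
    forall B, borel_on Omega B -> 0 <= mu B &
    forall delta : R, 0 < delta ->
      mu (nbhd_set F delta `&` Omega) = mu Omega /\ mu Omega = 1]].

Definition extremal_point (R : realType) (E : lmodType R) (M : set E) (m : E) :
    Prop :=
  M m /\
  forall (m1 m2 : E) (c1 c2 : R), M m1 -> M m2 -> m1 <> m2 ->
    0 <= c1 <= 1 -> 0 <= c2 <= 1 -> c1 + c2 = 1 ->
    m = c1 *: m1 + c2 *: m2 ->
    c1 = 1 - c2 /\ (c1 = 0 \/ c1 = 1).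

(* Main.v *)
(** If [mu] charges both [B] and its complement, then [mu] is a proper convex
    combination of the conditional measures [mu (_ `&` B) / mu B] and
    [mu (_ `\` B) / mu (Omega `\` B)], which are again density measures since
    [mu] vanishes outside each [nbhd_set F delta], and which differ at [B].
    Conversely, a convex component of a 0-1 density measure inherits its null
    sets, hence agrees with it on every Borel set. *)

Require Import Defs.
From mathcomp Require Import all_boot all_order all_algebra.
From mathcomp Require Import all_classical all_reals all_analysis.

Set Implicit Arguments.
Unset Strict Implicit.
Unset Printing Implicit Defensive.

Import Order.TTheory GRing.Theory Num.Theory.
Import numFieldNormedType.Exports.
Local Open Scope classical_set_scope.
Local Open Scope ring_scope.

Lemma borel_on_sub (T : topologicalType) (Omega A : set T) :
  borel_on Omega A -> A `<=` Omega.
Proof.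
apply: (smallest_sub (X := [set A | A `<=` Omega])).
  split=> [|B _|B sB]; [exact: sub0set|exact: subDsetl|].
  by apply: bigcup_sub => i _; exact: sB.
by move=> _ [U _ <-]; exact: subIsetr.
Qed.

Lemma borel_onT (T : topologicalType) (Omega : set T) : borel_on Omega Omega.
Proof.
rewrite -[X in borel_on _ X]setD0; apply: sigma_algebraCD.
exact: sigma_algebra0.
Qed.

Lemma borel_onU (T : topologicalType) (Omega A B : set T) :
  borel_on Omega A -> borel_on Omega B -> borel_on Omega (A `|` B).
Proof.
move=> bA bB; rewrite -bigcup2E; apply: sigma_algebra_bigcup.
by case=> [//|[//|i]]; exact: sigma_algebra0.
Qed.

(** De Morgan, with complements taken relative to [Omega]; since [A] and [B] lie in [Omega], the
    double complements give them back. *)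
Lemma borel_onI (T : topologicalType) (Omega A B : set T) :
  borel_on Omega A -> borel_on Omega B -> borel_on Omega (A `&` B).
Proof.
move=> bA bB.
have -> : A `&` B = Omega `\` ((Omega `\` A) `|` (Omega `\` B)).
  by rewrite setDUr !setDD (setIidr (borel_on_sub bA)) (setIidr (borel_on_sub bB)).
by apply: sigma_algebraCD; apply: borel_onU; exact: sigma_algebraCD.
Qed.

Lemma borel_onD (T : topologicalType) (Omega A B : set T) :
  borel_on Omega A -> borel_on Omega B -> borel_on Omega (A `\` B).
Proof.
move=> bA bB.
have -> : A `\` B = A `&` (Omega `\` B).
  by rewrite setIDA (setIidl (borel_on_sub bA)).
by apply: borel_onI => //; exact: sigma_algebraCD.
Qed.

Lemma lebesgue_n_ge0 {R : realType} {n : nat} (A : set 'rV[R]_n) :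
  (0 <= lebesgue_n A)%E.
Proof.
apply: le_ereal_inf_tmp => _ [P [a [b [ab _ ->]]]].
apply: esum_ge0 => k _; rewrite lee_fin; apply: prodr_ge0 => i _.
by rewrite subr_ge0.
Qed.

(** Every cover of [B] by boxes also covers [A], so the infimum for [A] runs over a larger
    family. *)
Lemma lebesgue_n_null_sub (R : realType) (n : nat) (A B : set 'rV[R]_n) :
  A `<=` B -> lebesgue_n B = 0%E -> lebesgue_n A = 0%E.
Proof.
move=> AB B0; apply/eqP; rewrite eq_le lebesgue_n_ge0 andbT -B0.
apply: ereal_inf_le_tmp => v [P [a [b [ab Bab ->]]]].
by exists P, a, b; split=> //; exact: subset_trans Bab.
Qed.

Lemma ba_set0 (R : realType) (n : nat) (Omega : set 'rV[R]_n)
    (mu : set 'rV[R]_n -> R^o) :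
  ba Omega mu -> mu set0 = 0.
Proof.
move=> bmu; have b0 : borel_on Omega set0 by exact: sigma_algebra0.
have := ba_additive bmu b0 b0 (setI0 _).
by rewrite setU0 -[X in X = _]addr0 => /addrI.
Qed.

Lemma ba_split (R : realType) (n : nat) (Omega : set 'rV[R]_n)
    (mu : set 'rV[R]_n -> R^o) (A B : set 'rV[R]_n) :
  ba Omega mu -> borel_on Omega A -> borel_on Omega B ->
  mu A = mu (A `&` B) + mu (A `\` B).
Proof.
move=> bmu bA bB; rewrite -(ba_additive bmu) ?setUIDK//.
- exact: borel_onI.
- exact: borel_onD.
- by rewrite setDE setIACA setICr setI0.
Qed.

(** The normalisation sits under the quantifier over [delta]; the radius 1 extracts it. *)
Lemma Dens_mass (R : realType) (n : nat) (Omega F : set 'rV[R]_n)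
    (mu : set 'rV[R]_n -> R^o) :
  Dens Omega F mu -> mu Omega = 1.
Proof. by case=> _ _ /(_ 1 ltr01) []. Qed.

(* A non-Borel set has measure 0 by convention, so the mass condition in
   [Dens] already forces the neighbourhoods to be Borel. *)
Lemma Dens_borel_nbhd (R : realType) (n : nat) (Omega F : set 'rV[R]_n)
    (mu : set 'rV[R]_n -> R^o) (delta : R) :
  Dens Omega F mu -> 0 < delta -> borel_on Omega (nbhd_set F delta `&` Omega).
Proof.
case=> bmu _ + d0 => /(_ delta d0) [e1 e2]; apply: contrapT => /(ba_out bmu).
by rewrite e1 e2 => /eqP; rewrite oner_eq0.
Qed.

Lemma Dens_le (R : realType) (n : nat) (Omega F : set 'rV[R]_n)
    (mu : set 'rV[R]_n -> R^o) (A B : set 'rV[R]_n) :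
  Dens Omega F mu -> borel_on Omega A -> borel_on Omega B ->
  A `<=` B -> mu A <= mu B.
Proof.
move=> [bmu mu0 _] bA bB AB.
rewrite (ba_split bmu bB bA) setIidr// lerDl; apply: mu0.
exact: borel_onD.
Qed.

Lemma Dens_compl (R : realType) (n : nat) (Omega F : set 'rV[R]_n)
    (mu : set 'rV[R]_n -> R^o) (B : set 'rV[R]_n) :
  Dens Omega F mu -> borel_on Omega B -> mu B + mu (Omega `\` B) = 1.
Proof.
move=> Dmu bB; rewrite -(Dens_mass Dmu); case: Dmu => bmu _ _.
by rewrite (ba_split bmu (@borel_onT _ Omega) bB) (setIidr (borel_on_sub bB)).
Qed.

(** The Borel test enforces the convention [ba_out]: a non-Borel [A] may have a Borel trace on [D],
    so the quotient need not vanish there by itself. *)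
Definition conditional {R : realType} {n : nat} (Omega : set 'rV[R]_n)
    (mu : set 'rV[R]_n -> R^o) (D : set 'rV[R]_n) : set 'rV[R]_n -> R^o :=
  fun A => if `[< borel_on Omega A >] then mu (A `&` D) / mu D else 0.

Lemma conditionalE (R : realType) (n : nat) (Omega : set 'rV[R]_n)
    (mu : set 'rV[R]_n -> R^o) (D A : set 'rV[R]_n) :
  borel_on Omega A -> conditional Omega mu D A = mu (A `&` D) / mu D.
Proof. by rewrite /conditional => bA; case: asboolP. Qed.

Lemma Dens_conditional (R : realType) (n : nat) (Omega F : set 'rV[R]_n)
    (mu : set 'rV[R]_n -> R^o) (D : set 'rV[R]_n) :
  Dens Omega F mu -> borel_on Omega D -> mu D != 0 ->
  Dens Omega F (conditional Omega mu D).
Proof.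
move=> Dmu bD muD0; have [bmu mu_ge0 mass] := Dmu.
have muD : 0 < mu D by rewrite lt_neqAle eq_sym muD0 mu_ge0.
have bI A : borel_on Omega A -> borel_on Omega (A `&` D).
  by move=> bA; exact: borel_onI.
have cE := @conditionalE R n Omega mu D.
have cge0 A : borel_on Omega A -> 0 <= conditional Omega mu D A.
  by move=> bA; rewrite cE// divr_ge0// mu_ge0//; exact: bI.
have cT : conditional Omega mu D Omega = 1.
  rewrite cE; last exact: borel_onT.
  by rewrite (setIidr (borel_on_sub bD)) divff.
split=> // [|delta d0].
- split=> [A|A B bA bB AB0||A bA A0].
  + by rewrite /conditional; case: asboolP.
  + rewrite !cE//; last exact: borel_onU.
    rewrite setIUl (ba_additive bmu) ?mulrDl//; [exact: bI|exact: bI|].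
    by rewrite setIACA AB0 set0I.
  (* The bound 1 comes from monotonicity: [A] meets [D] in a subset of [D]. *)
  + exists 1 => A bA; rewrite ger0_norm ?cge0// cE// ler_pdivrMr// mul1r.
    by apply: (Dens_le Dmu) => //; exact: bI.
  + rewrite cE// (ba_null bmu) ?mul0r//; first exact: bI.
    by apply: lebesgue_n_null_sub A0; exact: subIsetl.
- split=> //; rewrite cT; have bN := Dens_borel_nbhd Dmu d0.
  have [NO O1] := mass _ d0.
  set N := nbhd_set F delta `&` Omega in bN NO *.
  have bDN : borel_on Omega (D `\` N) by exact: borel_onD.
  (* [N] carries the full mass 1, so its complement in [Omega] is null, and this complement contains
     the part of [D] outside [N]. *)
  have DN0 : mu (D `\` N) = 0.
    apply/eqP; rewrite eq_le mu_ge0// andbT.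
    have /= := Dens_compl Dmu bN; rewrite NO O1.
    rewrite -[X in _ = X]addr0 => /addrI <-.
    apply: (Dens_le Dmu) => //; first exact: sigma_algebraCD.
    exact: (setSD (borel_on_sub bD)).
  rewrite cE//; have := ba_split bmu bD bN.
  by rewrite DN0 addr0 setIC => <-; exact: divff.
Qed.

(** A sum of two nonnegative terms vanishes only if both do, and the strictly positive weights can
    be cancelled. *)
Lemma Dens_convex_null (R : realType) (n : nat) (Omega F : set 'rV[R]_n)
    (mu m1 m2 : set 'rV[R]_n -> R^o) (c1 c2 : R) (B : set 'rV[R]_n) :
  Dens Omega F m1 -> Dens Omega F m2 -> 0 < c1 -> 0 < c2 ->
  mu = c1 *: m1 + c2 *: m2 -> borel_on Omega B -> mu B = 0 ->
  m1 B = 0 /\ m2 B = 0.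
Proof.
move=> [_ p1 _] [_ p2 _] c1_gt0 c2_gt0 -> bB.
(* Module operations on set functions are pointwise, and scaling in [R^o] is multiplication in
   [R]. *)
change (c1 * m1 B + c2 * m2 B = 0 -> m1 B = 0 /\ m2 B = 0).
have m1_ge0 := p1 B bB; have m2_ge0 := p2 B bB.
move=> /eqP; rewrite paddr_eq0 ?mulr_ge0// ?(ltW c1_gt0) ?(ltW c2_gt0)//.
by rewrite !mulf_eq0 (gt_eqF c1_gt0) (gt_eqF c2_gt0) => /andP[/eqP -> /eqP ->].
Qed.

Theorem proposition5p14 (R : realType) (n : nat) (Omega F : set 'rV[R]_n)
    (mu : set 'rV[R]_n -> R^o) :
  borel_set Omega ->
  F `<=` closure Omega -> F !=set0 -> closed F ->
  lebesgue_n (F `&` Omega) = 0%E ->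
  Dens Omega F mu ->
  extremal_point (Dens Omega F) mu <->
  (forall B, borel_on Omega B -> mu B = 0 \/ mu (Omega `\` B) = 0).
Proof.
move=> _ _ _ _ _ Dmu; have [bmu mu_ge0 _] := Dmu; split.
- move=> [_ ext] B bB.
  have bC : borel_on Omega (Omega `\` B) by exact: sigma_algebraCD.
  have BC1 := Dens_compl Dmu bB.
  have [/eqP|B0] := boolP (mu B == 0); first by left.
  have [/eqP|C0] := boolP (mu (Omega `\` B) == 0); first by right.
  have muB_ge0 := mu_ge0 _ bB; have muC_ge0 := mu_ge0 _ bC.
  pose m1 := conditional Omega mu B.
  pose m2 := conditional Omega mu (Omega `\` B).
  (* Evaluation at [B] gives 1 for [m1] and 0 for [m2]. *)
  have m12 : m1 <> m2.
    move=> /(congr1 (fun m => m B)).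
    rewrite /m1 /m2 !conditionalE// setIid divff// setDIK (ba_set0 bmu) mul0r.
    by move/eqP; rewrite oner_eq0.
  (* Law of total probability for [B] and its complement; for non-Borel arguments both sides are
     0. *)
  have mu12 : mu = (mu B : R) *: m1 + (mu (Omega `\` B) : R) *: m2.
    apply/funext => A.
    change (mu A = mu B * m1 A + mu (Omega `\` B) * m2 A).
    have [bA|nbA] := pselect (borel_on Omega A); last first.
      by rewrite /m1 /m2 /conditional (asboolF nbA) !mulr0 addr0 (ba_out bmu).
    rewrite /m1 /m2 !conditionalE// [X in X + _]mulrC [X in _ + X]mulrC.
    rewrite !divfK// (ba_split bmu bA bB) setIDA.
    by rewrite (setIidl (borel_on_sub bA)).
  have B01 : 0 <= mu B <= 1 by rewrite muB_ge0 -BC1 lerDl.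
  have C01 : 0 <= mu (Omega `\` B) <= 1 by rewrite muC_ge0 -BC1 lerDr.
  have D1 := Dens_conditional Dmu bB B0.
  have D2 := Dens_conditional Dmu bC C0.
  have [_ [B0'|B1]] := ext m1 m2 _ _ D1 D2 m12 B01 C01 BC1 mu12; [by left|right].
  (* With [mu B = 1], the total mass 1 leaves nothing for the complement. *)
  by move: BC1; rewrite B1 -[X in _ = X]addr0 => /addrI.
- move=> zero_one; split=> // m1 m2 c1 c2 D1 D2 m12 c1_01 c2_01 c12 mu12.
  split; first by rewrite -c12 addrK.
  have [/eqP|c1_neq0] := boolP (c1 == 0); first by left.
  have [/eqP|c1_neq1] := boolP (c1 == 1); first by right.
  (* With both weights strictly between 0 and 1, [m1] and [m2] are shown to coincide, against their
     being distinct. *)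
  exfalso; apply: m12; apply/funext => B.
  have [bB|nbB] := pselect (borel_on Omega B); last first.
    by case: D1 D2 => [b1 _ _] [b2 _ _]; rewrite (ba_out b1) ?(ba_out b2).
  have c1_gt0 : 0 < c1 by rewrite lt_neqAle eq_sym c1_neq0; case/andP: c1_01.
  have c2_gt0 : 0 < c2.
    have : c1 < 1 by rewrite lt_neqAle c1_neq1; case/andP: c1_01.
    by rewrite -subr_gt0 -c12 addrC addKr.
  have null A := @Dens_convex_null _ _ _ _ _ _ _ _ _ A D1 D2 c1_gt0 c2_gt0 mu12.
  case: (zero_one B bB) => [/(null B bB) [-> ->] //|].
  have bC : borel_on Omega (Omega `\` B) by exact: sigma_algebraCD.
  move=> /(null _ bC) [C1 C2].
  (* Both components vanish on the complement of [B], so each gives [B] the full mass 1. *)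
  move: (Dens_compl D1 bB) (Dens_compl D2 bB).
  by rewrite C1 C2 !addr0 => -> ->.
Qed.
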